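(* For every future-finite-universal order $(F,\leq_F)$, the subset order $(P_{\mathrm{fin}}(F),\leq^{\mathrm{dom}}_F)$ is universal.
   Context: ''Order'' means partial order. A countable order is future-finite if for every element $x$ the up-set $\{y: x\leq y\}$ is finite. An order $(P,\leq_P)$ is a suborder of $(Q,\leq_Q)$ if there is an order embedding, i.e. a map $E:P\to Q$ with $a\leq_P b\iff E(a)\leq_Q E(b)$. A countable order is future-finite-universal if it contains every future-finite order as a suborder, and universal if it contains every countable order as a suborder. $P_{\mathrm{fin}}(F)$ is the set of finite subsets of $F$, and for $A,B\in P_{\mathrm{fin}}(F)$, $A\leq^{\mathrm{dom}}_F B$ iff for every $a\in A$ there is $b\in B$ with $a\leq_F b$. This is a quasi-order; it is regarded as an order by choosing one representative of each equivalence class (namely the finite antichains of $F$). *)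

(* Defs.v *)
From HB Require Import structures.
From mathcomp Require Import all_boot all_order finmap.
From mathcomp Require Import boolp classical_sets functions cardinality.

Set Implicit Arguments.
Unset Strict Implicit.
Unset Printing Implicit Defensive.
Import Order.TTheory.

Local Open Scope order_scope.
Local Open Scope fset_scope.

(* Injectivity of such an E follows from antisymmetry in P. *)
Definition order_embedding (d1 d2 : Order.disp_t) (P : porderType d1)
    (Q : porderType d2) (E : P -> Q) : Prop :=
  {mono E : x y / x <= y}.

Definition suborder (d1 d2 : Order.disp_t) (P : porderType d1)
    (Q : porderType d2) : Prop :=
  exists E : P -> Q, order_embedding E.

(* "countable" includes "finite" here and below. *)
Definition countable_order (d : Order.disp_t) (P : porderType d) : Prop :=
  countable [set: P]%classic.

Definition future_finite (d : Order.disp_t) (P : porderType d) : Prop :=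
  countable_order P /\
  forall x : P, finite_set [set y : P | x <= y]%classic.

(* A future-finite-universal order need not itself be future-finite. *)
Definition future_finite_universal (d : Order.disp_t) (F : porderType d) :
    Prop :=
  countable_order F /\
  forall (d' : Order.disp_t) (P : porderType d'),
    future_finite P -> suborder P F.

Definition universal (d : Order.disp_t) (Q : porderType d) : Prop :=
  countable_order Q /\
  forall (d' : Order.disp_t) (P : porderType d'),
    countable_order P -> suborder P Q.

Section SubsetOrder.
Variables (d : Order.disp_t) (F : porderType d).
Implicit Types A B C : {fset F}.

Definition le_dom A B : bool :=
  [forall a : A, [exists b : B, val a <= val b]].

Lemma le_domP A B :
  reflect (forall a, a \in A -> exists2 b, b \in B & a <= b) (le_dom A B).
Proof.
apply: (iffP forallP) => [H a aA|H a].
  have /existsP[b ab] := H [` aA].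
  by exists (val b) => //; exact: valP.
have [b bB ab] := H _ (valP a).
by apply/existsP; exists [` bB].
Qed.

Lemma le_dom_refl : reflexive le_dom.
Proof. by move=> A; apply/le_domP => a aA; exists a. Qed.

Lemma le_dom_trans : transitive le_dom.
Proof.
move=> B A C /le_domP AB /le_domP BC; apply/le_domP => a /AB[b /BC[c cC bc] ab].
by exists c => //; exact: le_trans ab bc.
Qed.

Definition antichain A : bool :=
  [forall a : A, [forall b : A, (val a <= val b) ==> (a == b)]].

Lemma antichainP A :
  reflect {in A &, forall a b, a <= b -> a = b} (antichain A).
Proof.
apply: (iffP forallP) => [H a b aA bA ab|H a].
  by have /forallP/(_ [` bA])/implyP/(_ ab)/eqP/(congr1 val) := H [` aA].
apply/forallP => b; apply/implyP => ab; apply/eqP/val_inj.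
exact: H (valP a) (valP b) ab.
Qed.

(* le_dom is only a quasi-order on {fset F}; each of its equivalence classes
   contains exactly one antichain (le_dom_antichain_repr for existence,
   le_dom_anti for uniqueness), so the order it induces is carried by the
   finite antichains. *)
Lemma le_dom_anti A B :
  antichain A -> antichain B -> le_dom A B -> le_dom B A -> A = B.
Proof.
have sub X Y : antichain X -> le_dom X Y -> le_dom Y X -> {subset X <= Y}.
  move=> /antichainP aX /le_domP XY /le_domP YX x xX.
  have [y yY xy] := XY _ xX; have [z zX yz] := YX _ yY.
  have xz := aX _ _ xX zX (le_trans xy yz).
  suff -> : x = y by [].
  by apply/le_anti; rewrite xy xz yz.
move=> aA aB AB BA; apply/fsetP => x.
by apply/idP/idP; apply: sub.
Qed.

Lemma le_dom_antichain_repr A :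
  exists2 B, antichain B & le_dom A B && le_dom B A.
Proof.
pose maxA := [fset a in A | [forall b : A, (a <= val b) ==> (a == val b)]].
have maxP a : reflect (a \in A /\ forall b, b \in A -> a <= b -> a = b)
                      (a \in maxA).
  rewrite !inE; apply: (iffP andP) => -[aA H]; split=> //.
    by move=> b bA ab; have /forallP/(_ [` bA])/implyP/(_ ab)/eqP := H.
  by apply/forallP => b; apply/implyP => ab; apply/eqP/H => //; exact: valP.
exists maxA.
  by apply/antichainP => a b /maxP[_ aM] /maxP[bA _]; exact: aM.
apply/andP; split; last by apply/le_domP => a /maxP[aA _]; exists a.
apply/le_domP => a.
have [n] := ubnP #|` [fset b in A | a < b]|.
elim: n a => // n IHn a le_n aA.
have [aM|/maxP aM] := boolP (a \in maxA); first by exists a.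
have [b bA ab] : exists2 b, b \in A & a < b.
  apply: contrapT => nb; apply: aM; split=> // b bA; rewrite le_eqVlt.
  by case/orP => [/eqP//|ab]; case: nb; exists b.
have [|c cM bc] := IHn b _ bA; last by exists c => //; exact/ltW/(lt_le_trans ab).
rewrite -ltnS; apply: leq_trans le_n; rewrite ltnS; apply: fproper_ltn_card.
rewrite fproperE; apply/andP; split.
  by apply/fsubsetP => c; rewrite !inE /= => /andP[-> /(lt_trans ab)].
by apply/negP => /fsubsetP/(_ b); rewrite !inE /= bA ab ltxx => /(_ isT).
Qed.

Record fin_antichain := FinAntichain {
  fin_antichain_val :> {fset F};
  _ : antichain fin_antichain_val
}.

HB.instance Definition _ := [isSub for fin_antichain_val].
HB.instance Definition _ := [Choice of fin_antichain by <:].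

End SubsetOrder.

Fact dom_display (d : Order.disp_t) : Order.disp_t. Proof. exact: d. Qed.

Section SubsetPOrder.
Variables (d : Order.disp_t) (F : porderType d).

Definition le_fin_antichain (A B : fin_antichain F) : bool := le_dom A B.

Fact le_fin_antichain_refl : reflexive le_fin_antichain.
Proof. by move=> A; exact: le_dom_refl. Qed.

Fact le_fin_antichain_anti : antisymmetric le_fin_antichain.
Proof.
move=> A B /andP[AB BA]; apply/val_inj.
by apply: le_dom_anti => //; exact: valP.
Qed.

Fact le_fin_antichain_trans : transitive le_fin_antichain.
Proof. by move=> B A C; exact: le_dom_trans. Qed.

HB.instance Definition _ :=
  Order.Le_isPOrder.Build (dom_display d) (fin_antichain F)
    le_fin_antichain_refl le_fin_antichain_anti le_fin_antichain_trans.

End SubsetPOrder.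

Definition subset_order (d : Order.disp_t) (F : porderType d) :
    porderType (dom_display d) :=
  fin_antichain F.

(* Main.v *)
(** Enumerate the countable order P. Keeping only the comparisons x <= y in
    which y is enumerated no later than x gives a future-finite order on P, so it
    embeds into F by some map e. Send x to the finite set U x of all e y with
    y <= x and y enumerated no later than x. If x <= y and e a is in U x, then
    a <= y, and a is either enumerated no later than y, so that e a is in U y, or
    later than y, so that e a <= e y with e y in U y. Conversely, if U y
    dominates e x, then x <= z for some z <= y. *)

Require Import Defs.
From mathcomp Require Import all_boot all_order.
From HB Require Import structures.
From mathcomp Require Import finmap boolp classical_sets functions cardinality.

Set Implicit Arguments.
Unset Strict Implicit.
Unset Printing Implicit Defensive.
Import Order.TTheory.

Local Open Scope order_scope.
Local Open Scope fset_scope.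

(** An injection into [nat] carries a finite set to a finite set of numbers. Its underlying sequence
    determines that set and is coded by [pickle]. *)
Lemma countable_fset (T : choiceType) :
  countable [set: T]%classic -> countable [set: {fset T}]%classic.
Proof.
case/countable_injP => f f_inj; apply/pcard_injP.
pose code (A : {fset T}) := choice.pickle (enum_fset (f @` A) : seq nat).
suff code_inj : injective code by exists code => A B _ _ /code_inj.
move=> A B /(pcan_inj choice.pickleK) /val_inj /fsetP AB.
have f_inj' : injective f by move=> x y; apply: f_inj; rewrite inE.
by apply/fsetP => x; have := AB (f x); rewrite !mem_imfset.
Qed.

Section ForwardOrder.
Variables (d : Order.disp_t) (P : porderType d) (rank : P -> nat).

(** The phantom argument makes the order instance depend on [rank] and keeps it apart from the
    original order on [P]. *)
Definition forward_order of (P -> nat) : Type := P.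

HB.instance Definition _ := Choice.on (forward_order rank).

Definition forward_le (x y : forward_order rank) : bool :=
  ((x : P) <= y) && (rank y <= rank x)%N.

Fact forward_le_refl : reflexive forward_le.
Proof. by move=> x; rewrite /forward_le lexx leqnn. Qed.

Fact forward_le_anti : antisymmetric forward_le.
Proof.
by move=> x y /andP[/andP[xy _] /andP[yx _]]; apply: (@le_anti _ P); rewrite xy.
Qed.

Fact forward_le_trans : transitive forward_le.
Proof.
move=> y x z /andP[xy ryx] /andP[yz rzy].
by rewrite /forward_le (le_trans xy yz) (leq_trans rzy ryx).
Qed.

HB.instance Definition _ :=
  Order.Le_isPOrder.Build (dom_display d) (forward_order rank)
    forward_le_refl forward_le_anti forward_le_trans.

Hypothesis rank_inj : injective rank.

Lemma finite_rank_le n : finite_set [set y : P | (rank y <= n)%N]%classic.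
Proof.
apply: (@finite_preimage _ _ `I_n.+1 rank) => [x y _ _|]; first exact: rank_inj.
exact: finite_II.
Qed.

(** Everything above [x] has rank at most [rank x], and an injective rank leaves only finitely many
    such elements. *)
Lemma forward_future_finite : future_finite (forward_order rank).
Proof.
split=> [|x]; first by apply/pcard_injP; exists rank => x y _ _ /rank_inj.
by apply: sub_finite_set (finite_rank_le (rank x)) => y /andP[].
Qed.

End ForwardOrder.

Theorem theorem5p1p5 (d : Order.disp_t) (F : porderType d)
    (hF : future_finite_universal F) :
  universal (subset_order F).
Proof.
case: hF => countF univF; split.
  have /countable_injP[f f_inj] := countable_fset countF.
  apply/pcard_injP; exists (fun A : fin_antichain F => f (val A)).
  by move=> A B _ _ /f_inj fAB; apply/val_inj/fAB; rewrite inE.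
move=> d' P /countable_injP[rank rank_injT].
have rank_inj : injective rank by move=> x y; apply: rank_injT; rewrite inE.
(* This is the embedding of [forward_order rank] into [F], with the alias and [forward_le]
   unfolded. *)
have [e e_le] : exists e : P -> F,
    forall x y, (e x <= e y) = (x <= y) && (rank y <= rank x)%N.
  exact: univF (forward_future_finite rank_inj).
pose past x := [set y : P | y <= x /\ (rank y <= rank x)%N]%classic.
have past_fin x : finite_set (past x).
  by apply: sub_finite_set (finite_rank_le rank_inj (rank x)) => y [].
pose U x : {fset F} := e @` fset_set (past x).
have UP x a :
    reflect (exists2 y, a = e y & y <= x /\ (rank y <= rank x)%N) (a \in U x).
  apply: (iffP (imfsetP _ _ _ _)) => [[y /= yx ->]|[y -> yx]]; exists y => //.
    by move: yx; rewrite in_fset_set // inE.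
  by rewrite /= in_fset_set // inE.
have U_le x y : le_dom (U x) (U y) = (x <= y).
  apply/le_domP/idP => [xy|xy _ /UP[a -> [ax _]]].
    have [|_ /UP[z -> [zy _]]] := xy (e x); first by apply/UP; exists x.
    by rewrite e_le => /andP[xz _]; exact: le_trans xz zy.
  have ay := le_trans ax xy.
  have [ray|/ltnW rya] := leqP (rank a) (rank y).
    by exists (e a) => //; apply/UP; exists a.
  by exists (e y); [apply/UP; exists y | rewrite e_le ay].
(* [U x] need not be an antichain, so [V x] is chosen as an equivalent one; comparisons transfer by
   transitivity. *)
have /choice[V V_equiv] x :
    exists B : fin_antichain F, le_dom (U x) B && le_dom B (U x).
  by have [B aB UB] := le_dom_antichain_repr (U x); exists (FinAntichain aB).
exists V => x y; rewrite -U_le.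
have [/andP[UVx VUx] /andP[UVy VUy]] := (V_equiv x, V_equiv y).
apply/idP/idP => xy.
  exact: le_dom_trans UVx (le_dom_trans xy VUy).
exact: le_dom_trans VUx (le_dom_trans xy UVy).
Qed.
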